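(* Let $u_2=\phi(u,u_1)$ be an autonomous second-order ODE, with $\phi$ smooth on an open set $U\subseteq J^1(\mathbb R,\mathbb R)$, and let $(M,g)$ be its associated 3-dimensional Riemannian manifold. Suppose that $\left(\frac{\phi}{u_1}\right)_{u_1}=\frac{\partial}{\partial u_1}\left(\frac{\phi}{u_1}\right)\neq 0$ at every point of $M$. Let $f:I\to\mathbb R$ be a smooth function on an open interval $I\subseteq \mathbb R$ whose first-order prolongation $\mathrm{j}^1 f$ is a curve in $M$. If $\mathrm{j}^1 f$ is a geodesic of $(M,g)$, then $f$ is a solution of $u_2=\phi(u,u_1)$, that is, $f''(x)=\phi(f(x),f'(x))$ for all $x\in I$.
   Context: $J^1(\mathbb R,\mathbb R)$ is the first-order jet bundle, identified with $\mathbb R^3$ with standard coordinates $(x,u,u_1)$, where $x$ is the independent variable, $u$ the dependent variable and $u_1$ the first derivative. The function $\phi$ is smooth on an open subset $U\subseteq J^1(\mathbb R,\mathbb R)$ and depends only on $(u,u_1)$. Subscripts denote partial derivatives. The 3-dimensional Riemannian manifold associated with the ODE $u_2=\phi(u,u_1)$ is $M=\{(x,u,u_1)\in U: u_1\neq 0\}$ with the Riemannian metric $$g=(1 + u_1^2)\, dx^2 - 2 u_1\, dx\, du + \left( 1 + \frac{\phi^2}{u_1^2} \right) du^2 - 2 \frac{\phi}{u_1}\, du\, du_1 + du_1^2 .$$ Equivalently, $g=\omega^1\otimes\omega^1+\omega^2\otimes\omega^2+\omega^3\otimes\omega^3$ with $\omega^1=dx$, $\omega^2=-u_1\,dx+du$,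 $\omega^3=-\frac{\phi}{u_1}\,du+du_1$. The first-order prolongation of a smooth function $f:I\to\mathbb R$ is the curve $(\mathrm{j}^1 f)(x)=(x,f(x),f'(x))$, $x\in I$. A curve $\gamma$ in $M$ is a geodesic if $\nabla_{\dot\gamma(t)}\dot\gamma(t)=0$ for every $t$, where $\nabla$ is the Levi-Civita connection of $g$. *)

(* Defs.v *)
From HB Require Import structures.
From mathcomp Require Import all_boot all_order all_algebra.
From mathcomp Require Import all_classical all_reals all_analysis.
From mathcomp Require Import ring.
Set Implicit Arguments.
Unset Strict Implicit.
Unset Printing Implicit Defensive.
Import Order.TTheory GRing.Theory Num.Theory.
Import numFieldNormedType.Exports.
Local Open Scope classical_set_scope.
Local Open Scope ring_scope.

(* Differential geometry of an open subset M of R^(n+1). Functions, vector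
   fields and tensors on M are represented by total functions, of which only
   the values on M are ever constrained. *)
Section RiemannianGeometry.
Context {R : realType} {n : nat}.
Local Notation V := 'rV[R]_n.+1.
Implicit Types (M : set V) (p : V) (X Y Z : V -> V).

Definition coord_vec (i : 'I_n.+1) : V := delta_mx 0 i.

Definition partial (i : 'I_n.+1) (h : V -> R) : V -> R :=
  fun p => 'D_(coord_vec i) h p.

Fixpoint Ck_on M (k : nat) (h : V -> R) : Prop :=
  match k with
  | 0%N => forall p, M p -> {for p, continuous h}
  | k'.+1 => forall i, (forall p, M p -> derivable h p (coord_vec i)) /\
                       Ck_on M k' (partial i h)
  end.

Definition smooth_on M (h : V -> R) : Prop := forall k, Ck_on M k h.

Definition smooth_field M X : Prop :=
  forall i, smooth_on M (fun p => X p 0 i).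

Definition dirderiv X (h : V -> R) : V -> R := fun p => 'D_(X p) h p.

Definition lie_bracket X Y : V -> V := fun p =>
  \row_i (dirderiv X (fun q => Y q 0 i) p - dirderiv Y (fun q => X q 0 i) p).

(* No locality axiom is needed: multiplying a field vanishing on M by the
   indicator function of the complement of M, which is smooth on M, linearity
   in X and the Leibniz rule show that nabla X Y on M depends only on the
   restrictions of X and Y to M. *)
Definition affine_connection M (nabla : (V -> V) -> (V -> V) -> (V -> V)) :
    Prop :=
  [/\ (forall X Y, smooth_field M X -> smooth_field M Y ->
         smooth_field M (nabla X Y)),
      (forall (a b : V -> R) X Y Z, smooth_on M a -> smooth_on M b ->
         smooth_field M X -> smooth_field M Y -> smooth_field M Z ->
         forall p, M p ->
         nabla (fun q => a q *: X q + b q *: Y q) Z p =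
           a p *: nabla X Z p + b p *: nabla Y Z p),
      (forall X Y Z,
         smooth_field M X -> smooth_field M Y -> smooth_field M Z ->
         forall p, M p ->
         nabla X (fun q => Y q + Z q) p = nabla X Y p + nabla X Z p) &
      (forall (a : V -> R) X Y,
         smooth_on M a -> smooth_field M X -> smooth_field M Y ->
         forall p, M p ->
         nabla X (fun q => a q *: Y q) p =
           a p *: nabla X Y p + dirderiv X a p *: Y p)].

Definition torsion_free M (nabla : (V -> V) -> (V -> V) -> (V -> V)) : Prop :=
  forall X Y, smooth_field M X -> smooth_field M Y ->
  forall p, M p -> nabla X Y p - nabla Y X p = lie_bracket X Y p.

Definition metric_compatible M (g : V -> V -> V -> R)
    (nabla : (V -> V) -> (V -> V) -> (V -> V)) : Prop :=
  forall X Y Z, smooth_field M X -> smooth_field M Y -> smooth_field M Z ->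
  forall p, M p ->
  dirderiv X (fun q => g q (Y q) (Z q)) p =
    g p (nabla X Y p) (Z p) + g p (Y p) (nabla X Z p).

Definition levi_civita M (g : V -> V -> V -> R)
    (nabla : (V -> V) -> (V -> V) -> (V -> V)) : Prop :=
  [/\ affine_connection M nabla, torsion_free M nabla &
      metric_compatible M g nabla].

(* Component k of nabla_(d_i) d_j. *)
Definition christoffel (nabla : (V -> V) -> (V -> V) -> (V -> V))
    (k i j : 'I_n.+1) (p : V) : R :=
  nabla (cst (coord_vec i)) (cst (coord_vec j)) p 0 k.

Definition covariant_derivative (nabla : (V -> V) -> (V -> V) -> (V -> V))
    (gamma W : R -> V) (t : R) : V :=
  derive1 W t +
  \row_k \sum_i \sum_j
    christoffel nabla k i j (gamma t) * (derive1 gamma t) 0 i * (W t) 0 j.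

Definition geodesic (nabla : (V -> V) -> (V -> V) -> (V -> V))
    (I : set R) (gamma : R -> V) : Prop :=
  forall t, I t -> covariant_derivative nabla gamma (derive1 gamma) t = 0.

End RiemannianGeometry.

Section JetSpace.
Context {R : realType}.

Definition smooth1_on (I : set R) (f : R -> R) : Prop :=
  forall k x, I x -> derivable (derive1n k f) x 1.

(* J^1(R, R) is 'rV[R]_3, with coordinates (x, u, u1). *)
Definition ix : 'I_3 := @Ordinal 3 0 isT.
Definition iu : 'I_3 := @Ordinal 3 1 isT.
Definition iu1 : 'I_3 := @Ordinal 3 2 isT.

Definition jet (x u u1 : R) : 'rV[R]_3 := \row_(i < 3) [:: x; u; u1]`_i.

Definition prolongation (f : R -> R) : R -> 'rV[R]_3 :=
  fun x => jet x (f x) (derive1 f x).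

Definition ode_manifold (U : set 'rV[R]_3) : set 'rV[R]_3 :=
  U `&` [set p | p 0 iu1 != 0].

(* The polar form of the quadratic differential form
   (1 + u1^2) dx^2 - 2 u1 dx du + (1 + phi^2 / u1^2) du^2
     - 2 (phi / u1) du du1 + du1^2. *)
Definition ode_metric (phi : R -> R -> R) (p v w : 'rV[R]_3) : R :=
  let u1 := p 0 iu1 in
  let ph := phi (p 0 iu) u1 in
  (1 + u1 ^+ 2) * (v 0 ix * w 0 ix)
  - u1 * (v 0 ix * w 0 iu + v 0 iu * w 0 ix)
  + (1 + ph ^+ 2 / u1 ^+ 2) * (v 0 iu * w 0 iu)
  - ph / u1 * (v 0 iu * w 0 iu1 + v 0 iu1 * w 0 iu)
  + v 0 iu1 * w 0 iu1.

Definition omega1 (v : 'rV[R]_3) : R := v 0 ix.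
Definition omega2 (p v : 'rV[R]_3) : R := - p 0 iu1 * v 0 ix + v 0 iu.
Definition omega3 (phi : R -> R -> R) (p v : 'rV[R]_3) : R :=
  - (phi (p 0 iu) (p 0 iu1) / p 0 iu1) * v 0 iu + v 0 iu1.

Lemma ode_metric_coframe phi p v w :
  ode_metric phi p v w =
    omega1 v * omega1 w + omega2 p v * omega2 p w
    + omega3 phi p v * omega3 phi p w.
Proof. rewrite /ode_metric /omega1 /omega2 /omega3 -exprVn; ring. Qed.

End JetSpace.

(* Main.v *)
Require Import Defs.
From HB Require Import structures.
From mathcomp Require Import all_boot all_order all_algebra.
From mathcomp Require Import all_classical all_reals all_analysis.
From mathcomp Require Import ring.
Import Order.TTheory GRing.Theory Num.Theory.
Import numFieldNormedType.Exports.
Local Open Scope classical_set_scope.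
Local Open Scope ring_scope.

(** Lowering the index with the metric, the geodesic equation becomes
    2 g(gamma'', d_k) + sum_ij W^i W^j (2 d_i g_jk - d_k g_ij) = 0, W = gamma',
    which involves no Christoffel symbols. Pair it with the frame vector
    d_u + (phi / u1) d_u1, dual to omega^2. Along gamma = j^1 f the velocity has
    omega^1 = 1, omega^2 = 0 and omega^3 = f'' - phi, and everything cancels
    except -2 (f'' - phi)^2 (phi / u1)_u1; hence f'' = phi. *)

(** * The geodesic equation with lowered index *)

Section LeviCivita.
Context {R : realType} {n : nat}.
Local Notation V := 'rV[R]_n.+1.

Lemma smooth_on_cst (M : set V) (c : R) : smooth_on M (fun=> c).
Proof.
move=> k; elim: k c => [|k IH] c /=; first by move=> p _; exact: cst_continuous.
move=> i; split=> [p _|]; first exact: derivable_cst.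
suff -> : partial i (fun=> c : R) = fun=> 0 :> R by exact: IH.
by apply/funext => p; exact: derive_cst.
Qed.

Lemma smooth_field_cst (M : set V) (v : V) : smooth_field M (cst v).
Proof. move=> i; exact: smooth_on_cst. Qed.

(** Metric compatibility expands each [d_i g_jk] into lowered Christoffel symbols, and vanishing
    torsion makes these symmetric in the differentiated pair. The bracket then equals
    [2 A_ijk + A_kij - A_kji]; contracting with the symmetric [W^i W^j] kills the last difference,
    and the rest cancels the acceleration term. *)
Lemma geodesic_lagrange (M : set V) (g : V -> V -> V -> R)
    (nabla : (V -> V) -> (V -> V) -> (V -> V)) (I : set R) (gamma : R -> V) :
  (forall p v w, g p v w = g p w v) ->
  (forall p w, linear_for *%R (fun v => g p v w)) ->
  levi_civita M g nabla -> geodesic nabla I gamma ->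
  forall t k, I t -> M (gamma t) ->
  2 * g (gamma t) (derive1 (derive1 gamma) t) (coord_vec k)
  + \sum_i \sum_j derive1 gamma t 0 i * derive1 gamma t 0 j *
      (2 * partial i (fun q => g q (coord_vec j) (coord_vec k)) (gamma t)
       - partial k (fun q => g q (coord_vec i) (coord_vec j)) (gamma t)) = 0.
Proof.
move=> gC glin [_ tf mc] geo t k It Mp.
set p := gamma t in Mp *; set W := derive1 gamma t.
(* [A i j l] is the Christoffel symbol of the first kind at [p]. *)
pose D i j := nabla (cst (coord_vec i)) (cst (coord_vec j)) p.
pose A i j l := g p (D i j) (coord_vec l).
have DC i j : D i j = D j i.
  apply/eqP; rewrite -subr_eq0.
  have -> := tf _ _ (smooth_field_cst M (coord_vec i))
    (smooth_field_cst M (coord_vec j)) _ Mp.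
  by apply/eqP/rowP => l; rewrite [RHS]mxE mxE /dirderiv !derive_cst subrr.
have dg : forall i j l,
    partial i (fun q => g q (coord_vec j) (coord_vec l)) p = A i j l + A i l j.
  move=> i j l.
  have := mc (cst (coord_vec i)) (cst (coord_vec j)) (cst (coord_vec l))
    (smooth_field_cst _ _) (smooth_field_cst _ _) (smooth_field_cst _ _) _ Mp.
  by rewrite /dirderiv /partial /= => ->; rewrite (gC _ (coord_vec j)).
have W'E : derive1 (derive1 gamma) t =
    - \sum_i \sum_j (W 0 i * W 0 j) *: D i j.
  apply/eqP; rewrite -addr_eq0; apply/eqP.
  rewrite -[RHS](geo t It); congr (_ + _).
  apply/rowP => l; rewrite !mxE summxE; apply: eq_bigr => i _.
  rewrite summxE; apply: eq_bigr => j _.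
  by rewrite !mxE /christoffel -/p -/W mulrC mulrA.
pose G : {linear V -> R | *%R} :=
  HB.pack (fun v => g p v (coord_vec k))
    (GRing.isLinear.Build _ _ _ _ _ (glin p (coord_vec k))).
have -> : g p (derive1 (derive1 gamma) t) (coord_vec k) =
    - \sum_i \sum_j W 0 i * W 0 j * A i j k.
  rewrite W'E -[LHS]/(G _) raddfN raddf_sum; congr (- _).
  apply: eq_bigr => i _; rewrite raddf_sum; apply: eq_bigr => j _.
  exact: (linearZ_LR G).
have WAC : \sum_i \sum_j W 0 i * W 0 j * A k j i =
           \sum_i \sum_j W 0 i * W 0 j * A k i j.
  rewrite exchange_big; apply: eq_bigr => i _; apply: eq_bigr => j _.
  by rewrite (mulrC (W 0 j)).
have -> : \sum_i \sum_j W 0 i * W 0 j *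
      (2 * partial i (fun q => g q (coord_vec j) (coord_vec k)) p
       - partial k (fun q => g q (coord_vec i) (coord_vec j)) p) =
    2 * (\sum_i \sum_j W 0 i * W 0 j * A i j k)
    + (\sum_i \sum_j W 0 i * W 0 j * A k i j
       - \sum_i \sum_j W 0 i * W 0 j * A k j i).
  rewrite mulr_sumr -sumrB -big_split; apply: eq_bigr => i _ /=.
  rewrite mulr_sumr -sumrB -big_split; apply: eq_bigr => j _ /=.
  by rewrite !dg /A (DC i k); ring.
by rewrite WAC subrr addr0 mulrN addNr.
Qed.
End LeviCivita.

(** * Derivatives of the metric and of curves in jet space *)

Section JetGeometry.
Context {R : realType}.
Implicit Types (p v w : 'rV[R]_3) (phi : R -> R -> R).

Lemma ode_metricC phi p v w : ode_metric phi p v w = ode_metric phi p w v.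
Proof. by rewrite !ode_metric_coframe; ring. Qed.

Lemma ode_metric_linear phi p w :
  linear_for *%R (fun v => ode_metric phi p v w).
Proof.
by move=> a u v; rewrite !ode_metric_coframe /omega1 /omega2 /omega3 !mxE; ring.
Qed.

(** The difference quotients along [v] vanish identically. This serves [phi / u1] in the direction
    of [x]. *)
Lemma is_derive_invariant (h : 'rV[R]_3 -> R) p v :
  (forall s : R, h (s *: v + p) = h p) -> is_derive p v h 0.
Proof.
move=> hv.
have E : (fun s : R => s^-1 *: ((h \o shift p) (s *: v) - h p)) = cst 0.
  by apply/funext => s /=; rewrite hv subrr scaler0.
split; first by rewrite /derivable E; exact: is_cvg_cst.
by rewrite /derive E lim_cst.
Qed.

Lemma is_derive_coord p v (i : 'I_3) :
  is_derive p v (fun q : 'rV[R]_3 => q 0 i) (v 0 i).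
Proof.
have idv : is_derive p v (id : 'rV[R]_3 -> 'rV[R]_3) v := is_derive_id _ _.
split; first exact: (derivable_mxP _ _ _).1 (@ex_derive _ _ _ _ _ _ _ idv) 0 i.
have := derive_mx (@ex_derive _ _ _ _ _ _ _ idv).
by rewrite derive_val => /matrixP/(_ 0 i); rewrite mxE.
Qed.

(** In the coframe expression, with [w] and [z] fixed, only the coefficients [u1] of [omega2] and
    [phi / u1] of [omega3] vary; the product rule gives the rest. *)
Lemma is_derive_ode_metric phi p v w z d :
  is_derive p v (fun q => phi (q 0 iu) (q 0 iu1) / q 0 iu1) d ->
  is_derive p v (fun q => ode_metric phi q w z)
    (- (v 0 iu1 * (w 0 ix * omega2 p z + z 0 ix * omega2 p w))
     - d * (w 0 iu * omega3 phi p z + z 0 iu * omega3 phi p w)).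
Proof.
set psi := fun q => _; move=> dpsi; have du1 := is_derive_coord p v iu1.
have d2 x : is_derive p v (fun q => omega2 q x) (- (v 0 iu1 * x 0 ix)).
  have -> : (fun q => omega2 q x) =
      (- x 0 ix) *: (fun q : 'rV[R]_3 => q 0 iu1) + cst (x 0 iu).
    apply/funext => q; rewrite /omega2.
    by transitivity (- x 0 ix * q 0 iu1 + x 0 iu); first ring.
  by apply: is_derive_eq; rewrite /GRing.scale /=; ring.
have d3 x : is_derive p v (fun q => omega3 phi q x) (- (d * x 0 iu)).
  have -> : (fun q => omega3 phi q x) =
      (- x 0 iu) *: psi + cst (x 0 iu1).
    apply/funext => q; rewrite /omega3.
    by transitivity (- x 0 iu * psi q + x 0 iu1); first by rewrite /psi; ring.
  by apply: is_derive_eq; rewrite /GRing.scale /=; ring.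
have dw := is_deriveD
  (is_deriveD (is_derive_cst (omega1 w * omega1 z : R) p v)
     (is_deriveM (d2 w) (d2 z)))
  (is_deriveM (d3 w) (d3 z)).
have -> : (fun q => ode_metric phi q w z) =
    cst (omega1 w * omega1 z)
    + (fun q => omega2 q w) * (fun q => omega2 q z)
    + (fun q => omega3 phi q w) * (fun q => omega3 phi q z).
  by apply/funext => q; rewrite ode_metric_coframe.
by apply: is_derive_eq dw _; rewrite /GRing.scale /=; ring.
Qed.

Lemma jetE (x u u1 : R) (i : 'I_3) : jet x u u1 0 i = [:: x; u; u1]`_i.
Proof. by rewrite mxE. Qed.

Lemma sum_jet (F : 'I_3 -> R) : \sum_i F i = F ix + F iu + F iu1.
Proof.
rewrite !big_ord_recl big_ord0 addr0 addrA.
by congr (F _ + F _ + F _); apply: val_inj.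
Qed.

Lemma coord_vecE (i j : 'I_3) : coord_vec i 0 j = (j == i)%:R :> R.
Proof. by rewrite mxE. Qed.

Lemma derive1_jet (a b c : R -> R) t :
  derivable a t 1 -> derivable b t 1 -> derivable c t 1 ->
  derive1 (fun x => jet (a x) (b x) (c x)) t =
    jet (derive1 a t) (derive1 b t) (derive1 c t).
Proof.
move=> da db dc.
have jE (i : 'I_1) (j : 'I_3) : (fun x => jet (a x) (b x) (c x) i j) =
    nth a [:: a; b; c] j.
  by apply/funext => x; rewrite mxE; case: j => -[|[|[|]]].
rewrite derive1E derive_mx.
  apply/matrixP => i j; rewrite mxE jE mxE !derive1E.
  by case: j => -[|[|[|//]]] lt_j.
apply/derivable_mxP => i j; rewrite jE.
case: {j}(nat_of_ord j) => [|[|[|j]]].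
- exact: da.
- exact: db.
- exact: dc.
(* The case split forgets [j < 3]; past the end of the list [nth] returns its default [a], which is
   derivable too. *)
- rewrite (nth_default a (isT : (size [:: a; b; c] <= j.+3)%N)); exact: da.
Qed.

End JetGeometry.

(** * The geodesic equation along a prolongation *)

Theorem proposition3p1 (R : realType) (U : set 'rV[R]_3) (phi : R -> R -> R)
    (nabla : ('rV[R]_3 -> 'rV[R]_3) -> ('rV[R]_3 -> 'rV[R]_3) ->
             ('rV[R]_3 -> 'rV[R]_3))
    (I : set R) (f : R -> R)
    (Uopen : open U)
    (phi_smooth : smooth_on U (fun p => phi (p 0 iu) (p 0 iu1)))
    (nabla_LC : levi_civita (ode_manifold U) (ode_metric phi) nabla)
    (phi_cond : forall p, ode_manifold U p ->
       partial iu1 (fun q => phi (q 0 iu) (q 0 iu1) / q 0 iu1) p != 0)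
    (Iopen : open I) (Iinterval : is_interval I)
    (f_smooth : smooth1_on I f)
    (f_in_M : forall x, I x -> ode_manifold U (prolongation f x))
    (f_geodesic : geodesic nabla I (prolongation f)) :
  forall x, I x -> derive1n 2 f x = phi (f x) (derive1 f x).
Proof.
move=> t It.
have Mp := f_in_M t It; have [Up /= u1N0] := Mp.
set p := prolongation f t in Mp Up u1N0 *.
(* The metric depends on [phi] only through this quotient, the coefficient in [omega3]. *)
pose psi (q : 'rV[R]_3) := phi (q 0 iu) (q 0 iu1) / q 0 iu1.
pose a := partial iu psi p; pose b := partial iu1 psi p.
have psi_x : is_derive p (coord_vec ix) psi 0.
  by apply: is_derive_invariant => s; rewrite /psi !mxE /= !mulr0 !add0r.
have psi_derivable i : derivable psi p (coord_vec i).
  apply: derivableM; first by have [/(_ p Up)] := phi_smooth 1%N i.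
  apply: derivableV => //.
  exact: (@ex_derive _ _ _ _ _ _ _ (is_derive_coord _ _ _)).
have psi_u : is_derive p (coord_vec iu) psi a by exact: derivableP.
have psi_u1 : is_derive p (coord_vec iu1) psi b by exact: derivableP.
have W x : I x ->
    derive1 (prolongation f) x = jet 1 (derive1 f x) (derive1n 2 f x).
  move=> Ix; rewrite derive1_jet ?derive1_id//.
  - exact: f_smooth 0%N _ Ix.
  - exact: f_smooth 1%N _ Ix.
have W' : derive1 (derive1 (prolongation f)) t =
    jet 0 (derive1n 2 f t) (derive1n 3 f t).
  (* Differentiating the velocity formula at [t] requires it on a neighbourhood of [t], which
     openness of [I] supplies. *)
  have near_W : \near t, derive1 (prolongation f) t =
      jet 1 (derive1 f t) (derive1n 2 f t).
    by near=> x; apply: W; near: x; exact: open_nbhs_nbhs.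
  rewrite derive1E (near_eq_derive _ near_W) -derive1E.
  rewrite derive1_jet ?derive1_cst//.
  - exact: f_smooth 1%N _ It.
  - exact: f_smooth 2%N _ It.
have L k := geodesic_lagrange _ _ _ _ _ (ode_metricC phi)
  (ode_metric_linear phi) nabla_LC f_geodesic t k It Mp.
(* The gradient of [psi] at [p]. *)
pose d (i : 'I_3) := [:: 0; a; b]`_i.
have dE i : is_derive p (coord_vec i) psi (d i).
  case: i => -[|[|[|//]]] lt_i; rewrite /d /=.
  - by rewrite (_ : Ordinal _ = ix)//; exact: val_inj.
  - by rewrite (_ : Ordinal _ = iu)//; exact: val_inj.
  - by rewrite (_ : Ordinal _ = iu1)//; exact: val_inj.
pose s := psi p; pose k := derive1n 2 f t; pose v := derive1 f t.
pose r := derive1n 3 f t.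
(* Trading [phi] for [s * v] removes all divisions, so that the identities below are polynomial and
   within reach of [ring]. *)
have phiE : phi (f t) v = s * v.
  by move: u1N0; rewrite /s /psi /p /prolongation !jetE => /divfK ->.
have o2 w : omega2 p w = - v * w 0 ix + w 0 iu by rewrite /omega2 !jetE.
have o3 w : omega3 phi p w = - s * w 0 iu + w 0 iu1 by [].
(* [O2] and [O3] are the values of [omega2] and [omega3] at [p] on the coordinate vectors; [G i j l]
   is the resulting [d_i g_jl]. *)
pose O2 (j : 'I_3) : R := - v * (ix == j)%:R + (iu == j)%:R.
pose O3 (j : 'I_3) : R := - s * (iu == j)%:R + (iu1 == j)%:R.
pose G i j l : R :=
  - ((iu1 == i)%:R * ((ix == j)%:R * O2 l + (ix == l)%:R * O2 j))
  - d i * ((iu == j)%:R * O3 l + (iu == l)%:R * O3 j).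
have dg i j l :
    partial i (fun q => ode_metric phi q (coord_vec j) (coord_vec l)) p =
    G i j l.
  have dgi := is_derive_ode_metric phi p (coord_vec i)
    (coord_vec j) (coord_vec l) (d i) (dE i).
  by rewrite /partial (@derive_val _ _ _ _ _ _ _ dgi) !o2 !o3 !coord_vecE.
set W1 := derive1 (prolongation f) in W W' L.
have [Wx Wu Wu1] : [/\ W1 t 0 ix = 1, W1 t 0 iu = v & W1 t 0 iu1 = k].
  by rewrite W// !jetE.
set W2 := derive1 W1 t in W' L.
have [W2x W2u W2u1] : [/\ W2 0 ix = 0, W2 0 iu = k & W2 0 iu1 = r].
  by rewrite W' !jetE.
clearbody W2; clear W W'.
have {}L l : 2 * (W2 0 ix * (ix == l)%:R + (- v * W2 0 ix + W2 0 iu) * O2 l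
                  + (- s * W2 0 iu + W2 0 iu1) * O3 l)
    + \sum_i \sum_j W1 t 0 i * W1 t 0 j * (2 * G i j l - G l i j) = 0.
  rewrite -[RHS](L l) ode_metric_coframe /omega1 !o2 !o3 !coord_vecE.
  congr (_ + _); apply: eq_bigr => i _; apply: eq_bigr => j _.
  by rewrite !dg.
(* The third derivative [r] enters the [u] component through [- s * (r - s * k)] and the [u1]
   component through [r - s * k], so adding [s] times the latter eliminates it. *)
have Lu : 2 * (k - s * (r - s * k) + s * v * (v * a + k * b)
    - k - (k - s * v) * (v * a + k * b) + (k - s * v) * a * v) = 0.
  rewrite -[RHS](L iu) !sum_jet Wx Wu Wu1 W2x W2u W2u1 /G /O2 /O3 /d /=.
  ring.
have Lu1 : 2 * (r - s * k - (v * a + k * b) * v + (k - s * v) * b * v) = 0.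
  rewrite -[RHS](L iu1) !sum_jet Wx Wu Wu1 W2x W2u W2u1 /G /O2 /O3 /d /=.
  ring.
(* [Lu + s * Lu1] is the pairing with [d_u + s d_u1], where [s = phi / u1]. *)
have : -2 * b * (k - s * v) ^+ 2 = 0.
  transitivity (0 + s * 0 : R); last by rewrite mulr0 addr0.
  by rewrite -{1}Lu -Lu1; ring.
move/eqP; rewrite !mulf_eq0 oppr_eq0 pnatr_eq0 orbb /=.
(* The hypothesis on [phi / u1] says exactly that [b] is nonzero, so the squared factor must
   vanish. *)
rewrite (negbTE (phi_cond _ Mp)) /= subr_eq0 => /eqP.
by rewrite -phiE.
Unshelve. all: by end_near.
Qed.
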